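(* Let $n$ be a positive integer and let $A_1,\dots,A_n$ be real symmetric positive semidefinite matrices of the same size. If $A_1+\dots+A_n\preceq nI$, then $$-\frac{1}{4}n(n-1)I\preceq\sum_{i\neq j}A_iA_j\preceq n(n-1)I,$$ where the sum is over all ordered pairs $(i,j)$ with $1\le i,j\le n$ and $i\ne j$.
   Context: For real symmetric matrices $A,B$ of the same size, $A\preceq B$ (Loewner order) means that $B-A$ is positive semidefinite. $I$ is the identity matrix. *)

(* Defs.v *)
From mathcomp Require Import all_boot all_order all_algebra.
From mathcomp Require Import reals.

Set Implicit Arguments.
Unset Strict Implicit.
Unset Printing Implicit Defensive.

Import Order.TTheory GRing.Theory Num.Theory.

Local Open Scope ring_scope.

(* Over the reals the quadratic form does not force symmetry, so symmetry is
   required explicitly. *)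
Definition psdmx (R : realType) (d : nat) (A : 'M[R]_d) : Prop :=
  A \is symmetricmx /\ forall x : 'cV[R]_d, 0 <= (x^T *m A *m x) 0 0.

Definition loewner_le (R : realType) (d : nat) (A B : 'M[R]_d) : Prop :=
  psdmx (B - A).

Notation "A ⪯ B" := (loewner_le A B) (at level 70, no associativity) : ring_scope.

(* Main.v *)
(** Write [S] for the sum of the [A i] and [D = A i - A j], [C = A i + A j]. From
    [C ⪯ S ⪯ n] one gets [D ^ 2 ⪯ n C], and summing over the pairs [i != j] gives
    [\sum_i A i ^ 2 ⪯ S ^ 2 / n + (n - 1) S]. Hence the off-diagonal sum
    [S ^ 2 - \sum_i A i ^ 2] is at least [(n - 1) / n (S ^ 2 - n S)], and
    [S ^ 2 - n S = (S - n / 2) ^ 2 - n ^ 2 / 4]. The upper bound follows from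
    [S ^ 2 / n ⪯ \sum_i A i ^ 2] and [S ^ 2 ⪯ n S ⪯ n ^ 2]. *)

Require Import Defs.
From mathcomp Require Import all_boot all_order all_algebra.
From mathcomp Require Import reals.
From mathcomp Require Import ring.

Import Order.TTheory GRing.Theory Num.Theory.
Local Open Scope ring_scope.

Lemma sum_offdiag (V : zmodType) (I : finType) (F : I -> I -> V) :
  \sum_(p : I * I | p.1 != p.2) F p.1 p.2 =
  \sum_i \sum_j F i j - \sum_i F i i.
Proof.
rewrite pair_bigA [X in _ = X - _](bigID (fun p => p.1 == p.2)) /=.
have -> : \sum_(p : I * I | p.1 == p.2) F p.1 p.2 = \sum_i F i i.
  rewrite (reindex_onto (fun i : I => (i, i)) fst) /=.
    by apply: eq_bigl => i; rewrite !eqxx.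
  by case=> i j /= /eqP ->.
by rewrite addrC addrK.
Qed.

Section PositiveSemidefinite.
Context {R : realType} {d : nat}.
Implicit Types (A B X : 'M[R]_d) (c : R).

Lemma symmetricmxP A : reflect (A^T = A) (A \is symmetricmx).
Proof.
by rewrite is_hermitianmxE expr0 scale1r map_mx_id // eq_sym; apply: eqP.
Qed.

Lemma psdmx_tr A : psdmx A -> A^T = A.
Proof. by case=> /symmetricmxP. Qed.

Lemma psdmxD A B : psdmx A -> psdmx B -> psdmx (A + B).
Proof.
move=> pA pB; split.
  by apply/symmetricmxP; rewrite raddfD /= !psdmx_tr.
move=> x; rewrite mulmxDr mulmxDl mxE.
by apply: addr_ge0; [apply: pA.2 | apply: pB.2].
Qed.

Lemma psdmxZ c A : 0 <= c -> psdmx A -> psdmx (c *: A).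
Proof.
move=> c0 pA; split.
  by apply/symmetricmxP; rewrite linearZ /= psdmx_tr.
move=> x; rewrite -scalemxAr -scalemxAl mxE.
by apply: mulr_ge0 => //; apply: pA.2.
Qed.

Lemma psdmx_gram X : psdmx (X^T *m X).
Proof.
split; first by apply/symmetricmxP; rewrite trmx_mul trmxK.
move=> x; rewrite mulmxA -trmx_mul -mulmxA mxE.
by apply: sumr_ge0 => i _; rewrite !mxE -expr2 sqr_ge0.
Qed.

Lemma psdmx_sqr X : X^T = X -> psdmx (X *m X).
Proof. by move=> sX; rewrite -{1}sX; apply: psdmx_gram. Qed.

Lemma psdmx_congr A X : X^T = X -> psdmx A -> psdmx (X *m A *m X).
Proof.
move=> sX pA; split.
  by apply/symmetricmxP; rewrite !trmx_mul sX psdmx_tr // mulmxA.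
move=> x; have := pA.2 (X *m x).
by rewrite trmx_mul sX !mulmxA.
Qed.

Lemma psdmx0 : psdmx (0 : 'M[R]_d).
Proof. by have := psdmx_gram 0; rewrite mulmx0. Qed.

Lemma psdmx_sum (I : finType) (P : pred I) (F : I -> 'M[R]_d) :
  (forall i, P i -> psdmx (F i)) -> psdmx (\sum_(i | P i) F i).
Proof. by move=> pF; apply: big_ind => //; [apply: psdmx0 | apply: psdmxD]. Qed.

(** With [D = A - B], the matrix [c * (c * (A + B) - D ^ 2)] is a sum of congruences of the three
    psd matrices [A], [B] and [c - (A + B)], by the symmetric matrices [D - c], [D + c] and [D]. *)
Lemma sqr_sub_loewner A B c : 0 < c -> psdmx A -> psdmx B ->
  A + B ⪯ c%:M -> (A - B) *m (A - B) ⪯ c *: (A + B).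
Proof.
move=> c0 pA pB pC; rewrite /loewner_le.
have sD : (A - B)^T = A - B by rewrite raddfB /= !psdmx_tr.
have sDm : (A - B - c%:M)^T = A - B - c%:M by rewrite raddfB /= sD tr_scalar_mx.
have sDp : (A - B + c%:M)^T = A - B + c%:M by rewrite raddfD /= sD tr_scalar_mx.
(* The first two congruences add up to [D (A + B) D - 2 c D ^ 2 + c ^ 2 (A + B)]; the third,
   [c D ^ 2 - D (A + B) D], removes the cubic part. *)
have -> : c *: (A + B) - (A - B) *m (A - B) =
  c^-1 *: ((A - B - c%:M) *m A *m (A - B - c%:M)
           + (A - B + c%:M) *m B *m (A - B + c%:M)
           + (A - B) *m (c%:M - (A + B)) *m (A - B)).
  apply: (scalerI (lt0r_neq0 c0)); rewrite scalerA divff ?lt0r_neq0 // scale1r.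
  rewrite !(mulmxDl, mulmxDr, mulmxBl, mulmxBr, mulNmx, mulmxN,
            mul_scalar_mx, mul_mx_scalar) -?scalemxAl -?scalemxAr.
  (* The identity is linear in the noncommutative words in [A] and [B]; once these are opaque,
     [ring] can check it entrywise. *)
  move: (A *m A *m A) (A *m A *m B) (A *m B *m A) (A *m B *m B)
        (B *m A *m A) (B *m A *m B) (B *m B *m A) (B *m B *m B)
        (A *m A) (A *m B) (B *m A) (B *m B) => *.
  by apply/matrixP => i j; rewrite !mxE; ring.
apply: psdmxZ; first by rewrite invr_ge0 ltW.
by apply: psdmxD; [apply: psdmxD|]; apply: psdmx_congr.
Qed.

End PositiveSemidefinite.

(** A matrix form of the variance identity. It serves both bounds: the left side is bounded above
    pair by pair for one, and is psd for the other. *)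
Lemma sum_sqr_sub (R : realType) (n d : nat) (A : 'I_n -> 'M[R]_d) :
  let S := \sum_i A i in
  \sum_i \sum_j (A i - A j) *m (A i - A j) =
  2 * n%:R *: (\sum_i A i *m A i) - 2 *: (S *m S).
Proof.
move=> S.
have row i : \sum_j (A i - A j) *m (A i - A j) =
    n%:R *: (A i *m A i) - A i *m S - S *m A i + \sum_j A j *m A j.
  rewrite mulmx_sumr mulmx_suml -[n in n%:R]card_ord scaler_nat -sumr_const.
  rewrite -!sumrB -big_split /=; apply: eq_bigr => j _.
  rewrite mulmxBl !mulmxBr; move: (A i *m A i) (A i *m A j) (A j *m A i) (A j *m A j) => *.
  by apply/matrixP => k l; rewrite !mxE; ring.
rewrite (eq_bigr _ (fun i _ => row i)) big_split /= !sumrB -scaler_sumr.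
rewrite -mulmx_suml -mulmx_sumr sumr_const card_ord -scaler_nat -/S.
move: (S *m S) (\sum_i _) => *.
by apply/matrixP => k l; rewrite !mxE; ring.
Qed.

Theorem theorem4 (R : realType) (n d : nat) (A : 'I_n -> 'M[R]_d)
    (n_gt0 : (0 < n)%N)
    (psdA : forall i, psdmx (A i))
    (sumA_le : \sum_(i < n) A i ⪯ n%:R%:M) :
  (- (1 / 4 * n%:R * (n%:R - 1)))%:M
    ⪯ \sum_(p : 'I_n * 'I_n | p.1 != p.2) A p.1 *m A p.2
  /\ \sum_(p : 'I_n * 'I_n | p.1 != p.2) A p.1 *m A p.2
    ⪯ (n%:R * (n%:R - 1))%:M.
Proof.
have c0 : 0 < n%:R :> R by rewrite ltr0n.
have c1 : 0 <= n%:R - 1 :> R by rewrite subr_ge0 ler1n.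
have sqr_sub := @sum_sqr_sub R n d A.
set S := \sum_(i < n) A i in sumA_le sqr_sub; cbv zeta in sqr_sub.
set Q := \sum_i A i *m A i in sqr_sub.
have pS : psdmx S by apply: psdmx_sum.
have -> : \sum_(p : 'I_n * 'I_n | p.1 != p.2) A p.1 *m A p.2 = S *m S - Q.
  rewrite (sum_offdiag _ _ (fun i j => A i *m A j)) mulmx_suml; congr (_ - _).
  by apply: eq_bigr => i _; rewrite mulmx_sumr.
have pairs : psdmx (2 * n%:R * (n%:R - 1) *: S - (2 * n%:R *: Q - 2 *: (S *m S))).
  have : psdmx (\sum_(p : 'I_n * 'I_n | p.1 != p.2)
      (n%:R *: (A p.1 + A p.2) - (A p.1 - A p.2) *m (A p.1 - A p.2))).
    apply: psdmx_sum => -[i j] /= ij; apply: sqr_sub_loewner => //.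
    rewrite /loewner_le.
    (* The summands of [S] other than [A i] and [A j] are psd, hence [A i + A j ⪯ S ⪯ n]. *)
    have -> : n%:R%:M - (A i + A j)
        = (n%:R%:M - S) + \sum_(k | (k != i) && (k != j)) A k.
      rewrite /S (bigD1 i) //= (bigD1 j) /=; last by rewrite eq_sym.
      by rewrite (addrA (A i)) [- (_ + \sum_(_ | _) _)]opprD addrA subrK.
    by apply: psdmxD => //; apply: psdmx_sum.
  rewrite (sum_offdiag _ _ (fun i j =>
    n%:R *: (A i + A j) - (A i - A j) *m (A i - A j))).
  have -> : \sum_i \sum_j (n%:R *: (A i + A j) - (A i - A j) *m (A i - A j))
      = 2 * n%:R * n%:R *: S - (2 * n%:R *: Q - 2 *: (S *m S)).
    rewrite -sqr_sub.
    under eq_bigr do rewrite sumrB -scaler_sumr big_split sumr_const card_ord /= -/S.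
    rewrite sumrB -scaler_sumr big_split /= sumr_const card_ord -sumrMnl -/S.
    congr (_ - _); rewrite sumrMnl -/S -scaler_nat.
    by apply/matrixP => k l; rewrite !mxE; ring.
  (* On the diagonal the square vanishes; removing these terms turns the coefficient [2 n ^ 2] of
     [S] into [2 n (n - 1)]. *)
  have -> : \sum_i (n%:R *: (A i + A i) - (A i - A i) *m (A i - A i))
      = 2 * n%:R *: S.
    rewrite scaler_sumr; apply: eq_bigr => i _; rewrite subrr mulmx0 subr0.
    by apply/matrixP => k l; rewrite !mxE; ring.
  congr psdmx; move: (S *m S) => *.
  by apply/matrixP => k l; rewrite !mxE; ring.
have variance : psdmx (2 * n%:R *: Q - 2 *: (S *m S)).
  rewrite -sqr_sub; apply: psdmx_sum => i _; apply: psdmx_sum => j _.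
  by apply: psdmx_sqr; rewrite raddfB /= !psdmx_tr.
(* The pair [(S, 0)] in [sqr_sub_loewner] gives [S ^ 2 ⪯ n S]. *)
have sqrS : psdmx (n%:R *: S - S *m S).
  have := @sqr_sub_loewner R d S 0 n%:R c0 pS psdmx0.
  by rewrite /loewner_le addr0 subr0; apply.
have centered : psdmx ((S - (n%:R / 2)%:M) *m (S - (n%:R / 2)%:M)).
  by apply: psdmx_sqr; rewrite raddfB /= psdmx_tr // tr_scalar_mx.
have c_neq0 := lt0r_neq0 c0.
split; rewrite /loewner_le.
(* The weights make the terms [(n - 1) S] cancel; the constant [n ^ 2 / 4] from [centered], times
   [(n - 1) / n], is the [n (n - 1) / 4] of the bound. *)
- have -> : S *m S - Q - (- (1 / 4 * n%:R * (n%:R - 1)))%:M =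
    (2 * n%:R)^-1 *: (2 * n%:R * (n%:R - 1) *: S - (2 * n%:R *: Q - 2 *: (S *m S)))
    + ((n%:R - 1) / n%:R) *: ((S - (n%:R / 2)%:M) *m (S - (n%:R / 2)%:M)).
    rewrite mulmxBl !mulmxBr !mul_scalar_mx mul_mx_scalar.
    move: (S *m S) => T; apply/matrixP => k l; rewrite !mxE.
    by case: (k == l); rewrite ?mulr1n ?mulr0n; field.
  apply: psdmxD; apply: psdmxZ => //.
  + by rewrite invr_ge0 mulr_ge0 // ltW.
  + by rewrite divr_ge0 // ltW.
(* The first term is [Q - S ^ 2 / n]; the last bracket telescopes to [n ^ 2 - S ^ 2]. *)
- have -> : (n%:R * (n%:R - 1))%:M - (S *m S - Q) =
    (2 * n%:R)^-1 *: (2 * n%:R *: Q - 2 *: (S *m S))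
    + ((n%:R - 1) / n%:R) *: (n%:R *: (n%:R%:M - S) + (n%:R *: S - S *m S)).
    move: (S *m S) => T; apply/matrixP => k l; rewrite !mxE.
    by case: (k == l); rewrite ?mulr1n ?mulr0n; field.
  apply: psdmxD; apply: psdmxZ => //.
  + by rewrite invr_ge0 mulr_ge0 // ltW.
  + by rewrite divr_ge0 // ltW.
  + by apply: psdmxD => //; apply: psdmxZ => //; apply: ltW.
Qed.
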